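(* Let $u=u(x,t)$ be the solution to the scalar conservation law $$\partial_t u+\partial_x F(u)=0$$ subject to the initial condition $u(x,0)=f(x)$, and let $g(x):=F'(f(x))$ be its initial wave speed. Suppose that $g\in C^{1,\alpha}([0,1])$ for some $0<\alpha\leq 1$ and that $g$ is nonlinear. If a Borel subset $\Lambda$ of the space-time plane $\mathbb{R}^2$ intersects the characteristic line $L_s$ of the conservation law emanating from $s$ for every initial position $s\in[0,1]$, then $\dim_{\mathcal{H}}(\Lambda)\geq\alpha$.
   Context: $\dim_{\mathcal{H}}$ denotes Hausdorff dimension. $F$ is a (differentiable) real flux function and $f$ is the real-valued initial datum. Points of the space-time plane are written $(x,t)$. The characteristic line emanating from the initial position $s\in[0,1]$ is the line $L_s=\{(x,t)\in\mathbb{R}^2 : x=g(s)t+s\}$. $C^{1,\alpha}([0,1])$ is the space of continuously differentiable real-valued functions on $[0,1]$ whose derivative is $\alpha$-H\''older continuous. A function $g$ on $[0,1]$ is linear if $g(x)=kx+c$ for some constants $k,c\in\mathbb{R}$ and all $x\in[0,1]$; nonlinear means not linear in this (affine) sense. *)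

(* Defs.v *)
From HB Require Import structures.
From mathcomp Require Export all_boot all_order all_algebra.
From mathcomp Require Export all_classical all_reals all_analysis.

Set Implicit Arguments.
Unset Strict Implicit.
Unset Printing Implicit Defensive.

Import Order.TTheory GRing.Theory Num.Theory.
Export numFieldNormedType.Exports.

Local Open Scope classical_set_scope.
Local Open Scope ring_scope.

Section HausdorffDimension.
Context {R : realType} {T : Type} (d : T -> T -> R).
Implicit Types (A U : set T) (s delta : R).

(* The element 0 is adjoined so that the empty set has diameter 0. *)
Definition diameter U : \bar R :=
  ereal_sup (0%E |` [set (d p.1 p.2)%:E | p in U `*` U]).

(* Conventions: the empty set contributes 0 for every s, and 0 `^ 0 = 1. *)
Definition hausdorff_gauge s U : \bar R :=
  if U == set0 then 0%E else (diameter U `^ s)%E.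

Definition hausdorff_pre s delta A : \bar R :=
  ereal_inf [set (\sum_(0 <= k <oo) hausdorff_gauge s (U k))%E |
    U in [set U : (set T)^nat | A `<=` \bigcup_k U k /\
                                forall k, (diameter (U k) <= delta%:E)%E]].

Definition hausdorff_measure s A : \bar R :=
  ereal_sup [set hausdorff_pre s delta A | delta in [set delta | 0 < delta]].

Definition hausdorff_dim A : \bar R :=
  ereal_inf [set s%:E | s in [set s | 0 <= s /\ hausdorff_measure s A = 0%E]].

End HausdorffDimension.

Section Plane.
Context {R : realType}.
Implicit Types (p q : R * R).

(* The library's own distance on [R * R] is the sup distance. *)
Definition euclidean_dist p q : R :=
  Num.sqrt ((p.1 - q.1) ^+ 2 + (p.2 - q.2) ^+ 2).

Definition plane_borel : set (set (R * R)) := <<s [set U | open U] >>.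

End Plane.

Section FunctionsOnUnitInterval.
Context {R : realType}.
Implicit Types (g : R -> R) (alpha : R).

(* [dg] is the derivative of [g] on [0, 1], one-sided at the endpoints. *)
Definition unit_C1holder alpha g :=
  exists dg : R -> R,
    [/\ forall x, x \in `[0, 1] ->
          (g y - g x) / (y - x) @[y --> within [set` `[0, 1]] x^'] --> dg x,
        {within [set` `[0, 1]], continuous dg} &
        exists C : R, forall x y, x \in `[0, 1] -> y \in `[0, 1] ->
          `|dg x - dg y| <= C * `|x - y| `^ alpha].

Definition unit_linear g :=
  exists k c : R, forall x, x \in `[0, 1] -> g x = k * x + c.

End FunctionsOnUnitInterval.

Section ConservationLaw.
Context {R : realType}.
Implicit Types (F f : R -> R) (u phi : R * R -> R) (T : R).

Let leb := @lebesgue_measure R.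

(* Points of the plane are (x, t). *)
Definition dx phi (p : R * R) : R :=
  derive1 (fun x => phi (x, p.2)) p.1.
Definition dt phi (p : R * R) : R :=
  derive1 (fun t => phi (p.1, t)) p.2.

(* C^1, with compact support in {t < T}; the support may meet {t = 0}. *)
Definition test_function T phi :=
  [/\ forall x t, derivable (fun y => phi (y, t)) x 1 /\
                  derivable (fun r => phi (x, r)) t 1,
      continuous phi, continuous (dx phi), continuous (dt phi) &
      exists K : set (R * R),
        [/\ compact K, K `<=` [set p | p.2 < T] &
            forall p, ~ K p -> phi p = 0]].

(* Weak solutions on R x [0, T) of u_t + F(u)_x = 0 with u(x, 0) = f(x):
   for every test function phi,
     \iint_{0 < t < T} (u phi_t + F(u) phi_x) dx dt + \int f phi(x, 0) dx = 0.
   Classical and entropy solutions are weak solutions in this sense. *)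
Definition conservation_law_solution F f T u :=
  [/\ forall x, u (x, 0) = f x,
      forall K : set R, compact K -> leb.-integrable K (EFin \o f),
      forall K : set (R * R), compact K -> K `<=` [set p | 0 <= p.2 < T] ->
        (leb \x leb)%E.-integrable (K `&` [set p | 0 < p.2]) (EFin \o u) /\
        (leb \x leb)%E.-integrable (K `&` [set p | 0 < p.2])
          (EFin \o (F \o u)) &
      forall phi, test_function T phi ->
        \int[(leb \x leb)%E]_(p in [set p | 0 < p.2 < T])
           (u p * dt phi p + F (u p) * dx phi p)
        + \int[leb]_(x in setT) (f x * phi (x, 0)) = 0].

Definition initial_wave_speed F f : R -> R := fun x => derive1 F (f x).

Definition characteristic_line F f (s : R) : set (R * R) :=
  [set p | p.1 = initial_wave_speed F f s * p.2 + s].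

End ConservationLaw.

(* Main.v *)
Require Import Defs.
From mathcomp Require Import ring lra.

(** Write [g] for the initial wave speed and [dg] for its derivative.  Choose
    for every [s] a point [P s = (x_s, t_s)] of [Lambda] on the characteristic
    from [s].  The proof measures sets of initial positions by the Lebesgue
    measure of their image under [dg].  As [g] is not affine, [dg] is not
    constant, so by the intermediate value theorem the image of [0, 1]
    contains a nondegenerate interval.  The aim is to show that this image
    would be null if the [sigma]-dimensional measure of [Lambda] vanished for
    some [sigma < alpha].

    This follows once [0, 1] is cut into countably many pieces on each of
    which [dg x - dg y] is [O(|P x - P y|^alpha)]: a cover of [Lambda] by small
    sets then yields a cover of the image by intervals of small total length
    ([negligible_hoelder_image]).  The pieces come from the flow map
    [y |-> y + g(y) t_s] at the time of [P s], whose derivative at [s] is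
    [1 + dg(s) t_s].

    - Where this derivative is zero, [dg s = - 1 / t_s] is a function of [P s]
      alone, and the function is Lipschitz because [dg] is bounded
      ([tangential_negligible]).
    - Where it is not zero, the flow map is bi-Lipschitz near [s].
      Characteristics that start close to each other then reach nearby points
      only if their starting points are comparably near, that is,
      [x - y = O(|P x - P y|)], and the Hoelder condition on [dg] gives the
      exponent [alpha] ([transversal_negligible]).  Countably many pieces make
      the constants and the localization uniform
      ([tangential_or_transversal]). *)

Set Implicit Arguments.
Unset Strict Implicit.
Unset Printing Implicit Defensive.

Import Order.TTheory GRing.Theory Num.Theory.
Local Open Scope classical_set_scope.
Local Open Scope ring_scope.

(** * One-sided differentiability on the unit interval *)

Section UnitInterval.
Context {R : realType}.
Implicit Types (g dg : R -> R).

Definition unit_derivative g dg := forall x, x \in `[0, 1] ->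
  (g y - g x) / (y - x) @[y --> within [set` `[0, 1]] x^'] --> dg x.

Lemma unit_derivative_continuous g dg :
  unit_derivative g dg -> {within [set` `[0, 1]], continuous g}.
Proof.
move=> gdg; apply/subspace_continuousP => x xI.
have cdiff : (y - x) @[y --> within [set` `[0, 1]] x^'] --> (0 : R).
  have toI : within [set` `[0, 1]] x^' --> x.
    by apply: cvg_trans (cvg_within _) _; exact: cvg_within.
  rewrite -[X in _ --> X](subrr x).
  by apply: cvgB; [exact: toI | exact: cvg_cst].
have cg : g y - g x @[y --> within [set` `[0, 1]] x^'] --> (0 : R).
  rewrite -[X in _ --> X](mulr0 (dg x)); apply: cvg_trans (cvgM (gdg _ xI) cdiff).
  apply: near_eq_cvg; rewrite near_withinE.
  rewrite /dnbhs near_withinE; near=> y => /= yx _ /=.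
  by rewrite mulfVK// subr_eq0.
apply/cvgrPdist_lt => e e0.
move/cvgrPdist_lt/(_ _ e0) : cg; rewrite near_withinE /dnbhs near_withinE.
rewrite near_withinE; apply: filter_app; near=> y => /= H yI.
have [->|yx] := eqVneq y x; first by rewrite subrr normr0.
by have := H yx yI; rewrite sub0r normrN distrC.
Unshelve. all: by end_near. Qed.

Lemma unit_derivative_is_derive g dg x : unit_derivative g dg ->
  x \in `]0, 1[ -> is_derive (x : R) 1 g (dg x).
Proof.
move=> gdg; rewrite in_itv /= => /andP[x0 x1].
have := gdg x; rewrite in_itv/= !ltW// => /(_ isT) gx.
have {}gx : h^-1 *: (g (h *: 1 + x) - g x) @[h --> 0^'] --> dg x.
  apply/cvgrPdist_lt => e e0.
  move/cvgrPdist_lt/(_ _ e0) : gx; rewrite near_withinE /dnbhs near_withinE.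
  case=> d /= d0 Hd; rewrite near_withinE.
  exists (Num.min d (Num.min x (1 - x))) => /=.
    by rewrite !lt_min d0 x0 subr_gt0.
  move=> h /=; rewrite sub0r normrN !lt_min => /andP[hd /andP[hx hx1]] h0.
  have := Hd (h + x); rewrite /ball_/= opprD addrCA subrr addr0 normrN.
  rewrite -subr_eq0 addrK => /(_ hd h0).
  have hI : 0 <= h + x <= 1.
    by move: hx hx1; rewrite !ltr_norml => /andP[? ?] /andP[? ?]; lra.
  rewrite /= in_itv/= => /(_ hI).
  by rewrite mulrC /GRing.scale /= mulr1.
apply: DeriveDef; last exact/cvg_lim.
by apply/cvg_ex; exists (dg x).
Qed.

(** The bound on [xi] places it between [x] and [y] whichever of them is the
    smaller, without a case distinction for the users of the lemma. *)
Lemma unit_MVT g dg x y : unit_derivative g dg ->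
  x \in `[0, 1] -> y \in `[0, 1] ->
  exists2 xi, xi \in `[0, 1] &
    g y - g x = dg xi * (y - x) /\ `|xi - x| <= `|y - x|.
Proof.
move=> gdg.
suff key a b : a \in `[0, 1] -> b \in `[0, 1] -> a <= b ->
    exists2 xi, xi \in `[a, b] & g b - g a = dg xi * (b - a).
  move=> xI yI; have [xy|/ltW yx] := leP x y.
    have [xi] := key _ _ xI yI xy; rewrite in_itv/= => /andP[h1 h2] E.
    move: xI yI; rewrite !in_itv/= => /andP[? ?] /andP[? ?].
    exists xi; first by rewrite in_itv/=; lra.
    by split=> //; rewrite !ger0_norm ?subr_ge0// lerB.
  have [xi] := key _ _ yI xI yx; rewrite in_itv/= => /andP[h1 h2] E.
  move: xI yI; rewrite !in_itv/= => /andP[? ?] /andP[? ?].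
  exists xi; first by rewrite in_itv/=; lra.
  split; first by rewrite -(opprB (g x)) E -mulrN opprB.
  by rewrite !ler0_norm ?subr_le0//; lra.
rewrite !in_itv/= => /andP[a0 a1] /andP[b0 b1] ab.
apply: (MVT_segment ab).
  move=> z; rewrite in_itv/= => /andP[az zb].
  by apply: unit_derivative_is_derive gdg _; rewrite in_itv/=; lra.
apply: continuous_subspaceW (unit_derivative_continuous gdg).
by apply: subset_itv; rewrite bnd_simp.
Qed.

End UnitInterval.

Lemma unit_bounded {R : realType} (f : R -> R) :
  {within [set` `[0, 1]], continuous f} ->
  exists2 M, 0 <= M & forall x, x \in `[0, 1] -> `|f x| <= M.
Proof.
move=> cf; have [a _ fa] := EVT_max ler01 cf; have [b _ fb] := EVT_min ler01 cf.
exists (`|f a| + `|f b|) => [|x xI]; first by rewrite addr_ge0.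
have := fa x xI; have := fb x xI.
have := ler_norm (f a); have := ler_norm (- f b); rewrite normrN.
have := normr_ge0 (f a); have := normr_ge0 (f b).
by rewrite ler_norml => *; lra.
Qed.

Lemma unit_derivative_nonconstant {R : realType} (g dg : R -> R) :
  unit_derivative g dg -> ~ unit_linear g ->
  exists x y, [/\ x \in `[0, 1], y \in `[0, 1] & dg x < dg y].
Proof.
move=> gdg; apply: contra_notP => nlt.
exists (dg 0), (g 0) => x xI.
have zI : 0 \in `[0 : R, 1] by rewrite in_itv/= lexx ler01.
have [xi xiI [E _]] := unit_MVT gdg zI xI.
suff <- : dg xi = dg 0 by move: E; rewrite subr0 => <-; rewrite subrK.
by have [lt|lt|//] := ltgtP (dg xi) (dg 0); case: nlt;
  [exists xi, 0 | exists 0, xi].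
Qed.

Lemma nonconstant_image_not_negligible {R : realType} (h : R -> R) x y :
  {within [set` `[0, 1]], continuous h} ->
  x \in `[0, 1] -> y \in `[0, 1] -> h x < h y ->
  ~ lebesgue_measure.-negligible (h @` [set` `[0, 1]]).
Proof.
move=> ch xI yI hxy hN.
have sub : `[h x, h y] `<=` h @` [set` `[0, 1]].
  move=> v; rewrite /= in_itv/= => /andP[xv vy].
  have key a b : a \in `[0, 1] -> b \in `[0, 1] -> a <= b ->
      Num.min (h a) (h b) <= v <= Num.max (h a) (h b) ->
      (h @` [set` `[0, 1]]) v.
    rewrite !in_itv/= => /andP[a0 a1] /andP[b0 b1] ab vab.
    have /(IVT ab)/(_ vab)[c] : {within `[a, b], continuous h}.
      by apply: continuous_subspaceW ch; apply: subset_itv; rewrite bnd_simp.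
    rewrite in_itv/= => /andP[ac cb] <-; exists c => //=.
    by rewrite in_itv/=; lra.
  have [xy|/ltW yx] := leP x y.
    by apply: (key x y) => //; rewrite ge_min le_max xv vy orbT.
  by apply: (key y x) => //; rewrite ge_min le_max xv vy orbT.
have : lebesgue_measure (`[h x, h y]%classic : set R) = 0%E.
  have hI := negligibleS (mu := @lebesgue_measure R) sub hN.
  by apply: (measure_negligible _ hI); exact: measurable_itv.
rewrite lebesgue_measure_itv/= lte_fin hxy -EFinB => /eqP.
by rewrite eqe subr_eq0 => /eqP E; rewrite E ltxx in hxy.
Qed.

(** * Hausdorff-null sets and Lebesgue-null images *)

Lemma negligible_small_covers {R : realType} (N : set R) :
  (forall e : R, 0 < e -> exists B : set R,
     [/\ measurable B, N `<=` B & (lebesgue_measure B <= e%:E)%E]) ->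
  lebesgue_measure.-negligible N.
Proof.
move=> smallN.
have /choice[B BP] n : exists B : set R, [/\ measurable B, N `<=` B &
    (lebesgue_measure B <= (n.+1%:R^-1)%:E)%E].
  by apply: smallN; rewrite invr_gt0.
have mB : measurable (\bigcap_n B n).
  by apply: bigcapT_measurable => n; have [] := BP n.
exists (\bigcap_n B n); split => //; last first.
  by move=> x Nx n _; have [_ + _] := BP n; apply.
apply/eqP; rewrite -measure_le0; apply/lee_addgt0Pr => e e0; rewrite add0e.
have [n ne] : exists n, (n.+1%:R^-1 : R) < e.
  exists (Num.truncn e^-1); rewrite invf_plt ?posrE//.
  by have /andP[] := truncn_itv (ltW (etrans (invr_gt0 e) e0)).
have [mBn _ leBn] := BP n.
apply: le_trans (le_trans leBn _); last by rewrite lee_fin ltW.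
by apply: le_measure; rewrite ?inE// => x; apply.
Qed.

Section HausdorffNull.
Context {R : realType} {T : Type} (d : T -> T -> R).

Lemma le_diameter (U : set T) p q : U p -> U q -> ((d p q)%:E <= diameter d U)%E.
Proof.
by move=> Up Uq; apply: ereal_sup_ubound; right; exists (p, q).
Qed.

Lemma diameter_ge0 (U : set T) : (0 <= diameter d U)%E.
Proof. by apply: ereal_sup_ubound; left. Qed.

Lemma hausdorff_gauge_ge0 s (U : set T) : (0 <= hausdorff_gauge d s U)%E.
Proof. by rewrite /hausdorff_gauge; case: ifP => // _; exact: poweR_ge0. Qed.

Lemma hausdorff_null_covers s (A : set T) e delta :
  hausdorff_measure d s A = 0%E -> 0 < delta -> 0 < e ->
  exists U : (set T)^nat,
    [/\ A `<=` \bigcup_k U k, forall k, (diameter d (U k) <= delta%:E)%E &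
        (\sum_(0 <= k <oo) hausdorff_gauge d s (U k) <= e%:E)%E].
Proof.
move=> H0 delta0 e0.
have : (hausdorff_pre d s delta A < e%:E)%E.
  apply: (@le_lt_trans _ _ 0%E); last by rewrite lte_fin.
  by rewrite -H0; apply: ereal_sup_ubound; exists delta.
move=> /ereal_inf_lt[_ [U [AU dU] <-] /ltW Ue].
by exists U.
Qed.

Hypothesis d_ge0 : forall p q, 0 <= d p q.

(** The hypothesis makes [h] a Hoelder function of [P x] at distances up to 1,
    so each set of a fine cover of [L] confines [h] to an interval whose length
    is at most a constant times the gauge of the set. *)
Lemma negligible_hoelder_image (s alpha K : R) (L : set T) (A : set R)
    (P : R -> T) (h : R -> R) :
  hausdorff_measure d s L = 0%E -> 0 <= s < alpha -> 0 <= K ->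
  (forall x, A x -> L (P x)) ->
  (forall x y, A x -> A y -> d (P x) (P y) <= 1 ->
     `|h x - h y| <= K * d (P x) (P y) `^ alpha) ->
  lebesgue_measure.-negligible (h @` A).
Proof.
move=> L0 /andP[s0 sa] K0 AL hP; apply: negligible_small_covers => e e0.
(* [2 * K + 1] in place of [2 * K] as the latter may vanish *)
have K2 : 0 < 2 * K + 1 by lra.
have [U [LU dU Ue]] := hausdorff_null_covers L0 ltr01 (divr_gt0 e0 K2).
pose r k := K * fine (diameter d (U k)) `^ alpha.
have r_ge0 k : 0 <= r k by rewrite mulr_ge0// powR_ge0.
have finD k : diameter d (U k) \is a fin_num.
  by rewrite ge0_fin_numE ?diameter_ge0// (le_lt_trans (dU k)) ?ltry.
(* [U k] has diameter [D <= 1], so all values of [h] at points that [P]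
   sends into it lie within [r k] of any one of them; as [s < alpha], the
   length [2 * K * D `^ alpha] is at most [2 * K * D `^ s]. *)
have /choice[B BP] k : exists B : set R, [/\ measurable B,
    forall x, A x -> U k (P x) -> B (h x) &
    (lebesgue_measure B <= (2 * K)%:E * hausdorff_gauge d s (U k))%E].
  have [[x [Ax Ux]]|nA] := pselect (exists x, A x /\ U k (P x)); last first.
    exists set0; split => //; first by move=> x Ax Ux; case: nA; exists x.
    rewrite measure0 mule_ge0 ?hausdorff_gauge_ge0//.
    by rewrite lee_fin mulr_ge0.
  exists `[h x - r k, h x + r k]%classic; split => //.
    move=> y Ay Uy /=; rewrite in_itv/= -ler_distl.
    have dxy : d (P y) (P x) <= fine (diameter d (U k)).
      by rewrite -lee_fin fineK// le_diameter.
    have d1 : fine (diameter d (U k)) <= 1 by rewrite -lee_fin fineK.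
    apply: le_trans (hP _ _ Ay Ax (le_trans dxy d1)) _.
    apply: ler_wpM2l => //; apply: ge0_ler_powR => //.
    - exact: ltW (le_lt_trans s0 sa).
    - exact: d_ge0.
    - exact: le_trans dxy.
  have /negbTE U0 : U k != set0 by apply/eqP => U0; move: Ux; rewrite U0.
  rewrite lebesgue_measure_itv/= /hausdorff_gauge U0.
  apply: (@le_trans _ _ (2 * r k)%:E).
    case: ifP => _; last by rewrite lee_fin mulr_ge0.
    by rewrite -EFinD lee_fin; lra.
  rewrite -[X in (X `^ _)%E]fineK// poweR_EFin -EFinM lee_fin /r mulrA.
  apply: ler_wpM2l; first by rewrite mulr_ge0.
  have : 0 <= fine (diameter d (U k)) <= 1.
    by rewrite -!lee_fin fineK// diameter_ge0 dU.
  move: (fine _) => D /andP[]; rewrite le_eqVlt => /predU1P[<- _|D0 D1].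
    by rewrite powR0 ?powR_ge0// gt_eqF// (le_lt_trans s0).
  by apply: ger_powR; rewrite ?D0 ?D1 // ltW.
exists (\bigcup_k B k); split.
- by apply: bigcupT_measurable => k; have [] := BP k.
- move=> _ [x Ax <-]; have [k _ Uk] := LU _ (AL _ Ax).
  by exists k => //; have [_ + _] := BP k; apply.
apply: (@le_trans _ _ (\sum_(0 <= k <oo) lebesgue_measure (B k))%E).
  apply: measure_sigma_subadditive => //.
  - by move=> k; have [] := BP k.
  - by apply: bigcupT_measurable => k; have [] := BP k.
apply: (@le_trans _ _
   (\sum_(0 <= k <oo) ((2 * K)%:E * hausdorff_gauge d s (U k)))%E).
  by apply: lee_nneseries => // k _; have [] := BP k.
rewrite nneseriesZl; last by move=> k _; exact: hausdorff_gauge_ge0.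
apply: (@le_trans _ _ ((2 * K)%:E * (e / (2 * K + 1))%:E)%E).
  by apply: lee_wpmul2l => //; rewrite lee_fin mulr_ge0.
rewrite -EFinM lee_fin mulrCA ger_pMr// ler_pdivrMr//; lra.
Qed.

End HausdorffNull.

(** * Tangential and transversal initial positions *)

Section Plane.
Context {R : realType}.
Implicit Types p q : R * R.

Lemma euclidean_dist_ge0 p q : 0 <= euclidean_dist p q.
Proof. exact: sqrtr_ge0. Qed.

Lemma ler_dist_fst p q : `|p.1 - q.1| <= euclidean_dist p q.
Proof.
by rewrite -sqrtr_sqr ler_wsqrtr// lerDl sqr_ge0.
Qed.

Lemma ler_dist_snd p q : `|p.2 - q.2| <= euclidean_dist p q.
Proof.
by rewrite -sqrtr_sqr ler_wsqrtr// lerDr sqr_ge0.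
Qed.

End Plane.

Section Characteristics.
Context {R : realType}.
Variables (g dg : R -> R) (alpha C : R) (Lambda : set (R * R)) (s0 : R)
  (P : R -> R * R).
Hypothesis gdg : unit_derivative g dg.
Hypothesis dg_continuous : {within [set` `[0, 1]], continuous dg}.
Hypothesis dg_hoelder : forall x y, x \in `[0, 1] -> y \in `[0, 1] ->
  `|dg x - dg y| <= C * `|x - y| `^ alpha.
Hypothesis alpha01 : 0 < alpha <= 1.
Hypothesis s0_alpha : 0 <= s0 < alpha.
Hypothesis Lambda_null : hausdorff_measure euclidean_dist s0 Lambda = 0%E.
Hypothesis PL : forall s, s \in `[0, 1] -> Lambda (P s).
Hypothesis Pg : forall s, s \in `[0, 1] -> (P s).1 = g s * (P s).2 + s.

(** The derivative at [xi] of the flow map [y |-> y + g y * t] along the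
    characteristics, taken at the time [t] of the chosen point [P s]. *)
Definition stretch (s xi : R) := 1 + dg xi * (P s).2.

Definition tangential : set R := [set s | s \in `[0, 1] /\ stretch s s = 0].

(** The letter [eta] serves three purposes (lower bound on the stretching, size
    of the neighbourhood where the bound holds, size of the piece) so that
    a single countable parameter exhausts the transversal positions.  The
    radius [2 * eta] makes the neighbourhood of each point of the piece contain
    the whole piece. *)
Definition transversal (eta c : R) : set R :=
  [set s | [/\ s \in `[0, 1], `|s - c| <= eta &
    forall xi, xi \in `[0, 1] -> `|xi - s| <= 2 * eta -> eta <= `|stretch s xi|]].

(** From [1 + dg x * t = 0] and [1 + dg y * t' = 0] follows
    [dg x - dg y = dg x * dg y * (t - t')]: as [dg] is bounded, it is a
    Lipschitz function of the focusing time. *)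
Lemma tangential_negligible : lebesgue_measure.-negligible (dg @` tangential).
Proof.
have [M M0 dgM] := unit_bounded dg_continuous.
apply: (negligible_hoelder_image euclidean_dist_ge0 Lambda_null s0_alpha
  (mulr_ge0 M0 M0) (P := P)); first by move=> x [xI _]; exact: PL.
move=> x y [xI x0] [yI y0] d1.
have -> : dg x - dg y = dg x * dg y * ((P x).2 - (P y).2).
  apply/eqP; rewrite -subr_eq0.
  rewrite (_ : _ - _ = dg x * stretch y y - dg y * stretch x x).
    by rewrite x0 y0 !mulr0 subrr.
  by rewrite /stretch; ring.
rewrite !normrM; apply: ler_pM; rewrite ?mulr_ge0//.
  by apply: ler_pM => //; exact: dgM.
apply: le_trans (ler_dist_snd _ _) _.
have /predU1P[->|d0] : (euclidean_dist (P x) (P y) == 0) ||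
  (0 < euclidean_dist (P x) (P y)) by rewrite -le0r euclidean_dist_ge0.
  exact: powR_ge0.
by case/andP: alpha01 => _ a1; apply: ger1_powR; rewrite ?d0.
Qed.

(** By the mean value theorem the time-[t] flow map separates two points [x]
    and [y] of the piece by at least [eta * `|x - y|], while the characteristics
    from [x] and [y] are no farther apart at that time than a multiple of the
    distance from [P x] to [P y].  Hence [x - y] is Lipschitz in [P x - P y],
    and [dg x - dg y] is Hoelder in it. *)
Lemma transversal_negligible eta c : 0 < eta ->
  lebesgue_measure.-negligible (dg @` transversal eta c).
Proof.
move=> eta0.
have [M M0 gM] := unit_bounded (unit_derivative_continuous gdg).
have [alpha0 _] := andP alpha01.
have K0 : 0 <= (1 + M) / eta by rewrite divr_ge0 ?addr_ge0// ltW.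
apply: (negligible_hoelder_image euclidean_dist_ge0 Lambda_null s0_alpha
  (K := `|C| * ((1 + M) / eta) `^ alpha) _ (P := P)).
- by rewrite mulr_ge0 ?powR_ge0.
- by move=> x [xI _ _]; exact: PL.
move=> x y [xI xc xtr] [yI yc _] _.
set D := euclidean_dist _ _.
suff xyD : `|x - y| <= (1 + M) / eta * D.
  apply: le_trans (dg_hoelder xI yI) _.
  apply: le_trans (ler_wpM2r (powR_ge0 _ _) (ler_norm C)) _.
  rewrite -mulrA -powRM ?euclidean_dist_ge0//; apply: ler_wpM2l => //.
  apply: ge0_ler_powR => //; first exact: ltW.
  by rewrite nnegrE mulr_ge0 ?euclidean_dist_ge0.
have [xi xiI [E xiy]] := unit_MVT gdg xI yI.
have yx2 : `|y - x| <= 2 * eta.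
  have := ler_normD (y - c) (c - x); rewrite addrA subrK (distrC c).
  by lra.
have tr := xtr xi xiI (le_trans xiy yx2).
(* The separation at the time of [P x], with the position of the
   characteristic from [y] at that time read off from [P y]. *)
have Exy : (y - x) * stretch x xi =
    ((P y).1 - (P x).1) + g y * ((P x).2 - (P y).2).
  have Ex := Pg xI; have Ey := Pg yI.
  rewrite /stretch mulrDr mulr1 mulrA (mulrC _ (dg xi)) -E Ex Ey; ring.
rewrite mulrAC ler_pdivlMr// distrC.
apply: (@le_trans _ _ `|(y - x) * stretch x xi|).
  by rewrite normrM ler_wpM2l.
rewrite Exy mulrDl mul1r; apply: le_trans (ler_normD _ _) _; apply: lerD.
  by rewrite distrC ler_dist_fst.
by rewrite normrM ler_pM// ?gM// ler_dist_snd.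
Qed.

Lemma tangential_or_transversal (s : R) : s \in `[0, 1] ->
  tangential s \/ exists n j, transversal n.+1%:R^-1 (j%:R / n.+1%:R) s.
Proof.
move=> sI; have [s_tan|s_tr] := eqVneq (stretch s s) 0; [by left|right].
set v := `|stretch s s|; have v0 : 0 < v by rewrite normr_gt0.
set t := (P s).2; have t1 : 0 < `|t| + 1 by rewrite ltr_wpDl.
(* This precision on [dg] keeps the stretching at least [v / 2] near [s]; the
   [+ 1] covers the case [t = 0]. *)
have e0 : 0 < v / 2 / (`|t| + 1) by rewrite !divr_gt0.
have /subspace_continuousP/(_ s sI)/cvgrPdist_lt/(_ _ e0) := dg_continuous.
rewrite near_withinE => -[del /= del0 near_s].
pose m := Num.min (v / 2) (del / 3).
have m0 : 0 < m by rewrite lt_min !divr_gt0.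
have [n nm] : exists n, (n.+1%:R^-1 : R) < m.
  exists (Num.truncn m^-1); rewrite invf_plt ?posrE//.
  by have /andP[] := truncn_itv (ltW (etrans (invr_gt0 m) m0)).
move: nm; rewrite lt_min => /andP[nv nd].
have n0 : 0 < n.+1%:R :> R by [].
(* The grid point of mesh [1 / (n + 1)] just below [s] is the center. *)
exists n, (Num.truncn (s * n.+1%:R)); split => //.
  move: sI; rewrite in_itv/= => /andP[s_ge0 _].
  have := truncn_itv (mulr_ge0 s_ge0 (ltW n0)).
  move: (Num.truncn _) => j /andP[js sj].
  have -> : s - j%:R / n.+1%:R = (s * n.+1%:R - j%:R) / n.+1%:R.
    by field; rewrite gt_eqF.
  rewrite normrM (ger0_norm (_ : 0 <= _^-1)) ?invr_ge0// -[leRHS]mul1r.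
  rewrite ler_pM2r ?invr_gt0// ger0_norm ?subr_ge0// lerBlDr.
  by rewrite addrC natr1 ltW.
move: nv nd; move: (n.+1%:R^-1) => eta nv nd xi xiI xis; have := near_s xi.
rewrite /= => /(_ _ xiI) => H.
have {}H : `|dg s - dg xi| < v / 2 / (`|t| + 1).
  by apply: H; rewrite distrC; apply: le_lt_trans xis _; lra.
have : `|stretch s s - stretch s xi| <= v / 2.
  rewrite /stretch opprD addrACA subrr add0r -mulrBl normrM.
  rewrite ltr_pdivlMr// in H; apply: le_trans (ltW H).
  by rewrite ler_wpM2l// lerDl.
have := ler_normD (stretch s s - stretch s xi) (stretch s xi).
by rewrite subrK -/v; lra.
Qed.

Lemma unit_image_negligible : lebesgue_measure.-negligible (dg @` [set` `[0, 1]]).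
Proof.
apply: (negligibleS (mu := @lebesgue_measure R) (A := dg @` tangential `|`
    \bigcup_n \bigcup_j dg @` transversal n.+1%:R^-1 (j%:R / n.+1%:R))).
  move=> _ [s sI <-].
  have [s_tan|[n [j s_tr]]] := tangential_or_transversal sI.
    by left; exists s.
  by right; exists n => //; exists j => //; exists s.
apply: (negligibleU (mu := @lebesgue_measure R)); first exact: tangential_negligible.
apply: (negligible_bigcup (mu := @lebesgue_measure R)) => n.
apply: (negligible_bigcup (mu := @lebesgue_measure R)) => j.
by apply: transversal_negligible; rewrite invr_gt0.
Qed.

End Characteristics.

Theorem corollary5p1 (R : realType) (F f : R -> R) (T : R) (u : R * R -> R)
    (alpha : R) (Lambda : set (R * R))
    (F_diff : forall y, derivable F y 1)
    (T_gt0 : 0 < T)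
    (u_sol : conservation_law_solution F f T u)
    (alpha_gt0 : 0 < alpha) (alpha_le1 : alpha <= 1)
    (g_C1holder : unit_C1holder alpha (initial_wave_speed F f))
    (g_nonlinear : ~ unit_linear (initial_wave_speed F f))
    (Lambda_borel : plane_borel Lambda)
    (Lambda_meets : forall s, s \in `[0, 1] ->
       Lambda `&` characteristic_line F f s !=set0) :
  (alpha%:E <= hausdorff_dim euclidean_dist Lambda)%E.
Proof.
set g := initial_wave_speed F f in g_C1holder g_nonlinear.
have [dg [gdg cdg [C dgC]]] := g_C1holder.
apply: le_ereal_inf_tmp => _ [s [s_ge0 Lambda_null] <-].
rewrite lee_fin leNgt; apply/negP => s_lt.
(* Off the unit interval [P] takes the arbitrary value [(0, 0)]. *)
have /choice[P PP] x : exists p : R * R,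
    x \in `[0, 1] -> Lambda p /\ p.1 = g x * p.2 + x.
  have [xI|_] := boolP (x \in `[0, 1]); last by exists (0, 0).
  by have [p [Lp Cp]] := Lambda_meets x xI; exists p.
have [x [y [xI yI dgxy]]] := unit_derivative_nonconstant gdg g_nonlinear.
apply: (nonconstant_image_not_negligible cdg xI yI dgxy).
apply: (unit_image_negligible gdg cdg dgC (s0 := s) _ _ Lambda_null (P := P)).
- by rewrite alpha_gt0.
- by rewrite s_ge0.
- by move=> z /PP[].
- by move=> z /PP[].
Qed.
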